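(* Consider a two-user multiple-access network (users $A$ and $B$) with saturated traffic running slotted Aloha. Time is divided into slots of duration $T_\text{slot}$, equal to the common packet duration. In each slot, user $A$ transmits with probability $p_A$ and user $B$ with probability $p_B$, independently of each other and across slots. A slot is a successful channel access by a user exactly when that user is the only one transmitting. Then the channel cycle time of slotted Aloha is $$\Psi_\text{slotted-Aloha} = \frac{(1-p_A)p_B+(1-p_B)p_A}{(1-p_A)(1-p_B)p_Ap_B}\cdot T_\text{slot}.$$
   Context: Consider a multiple-access network with $N$ users sharing a channel. For times $t<t'$, let $M_n(t,t')$ denote the number of successful channel accesses of user $n$ between $t$ and $t'$. A moment is a refresh moment of user $i$ if and only if two conditions hold: a successful channel access of user $i$ ends at this moment, and the next successful channel access belongs to another user. The cycle time $\Gamma_i$ of user $i$ is the random variable defined as follows. Take two refresh moments $t_0<t_1$ of user $i$. - If they are consecutive refresh moments of user $i$, then $t_1-t_0$ is a cycle time of user $i$ iff $\min_n M_n(t_0,t_1)>0$. - If they are not consecutive, then $t_1-t_0$ is a cycle time iff $\min_n M_n(t_0,t_1)>0$ and $\min_n M_n(t_0,t')=0$, where $t'$ (with $t_0<t'<t_1$) is the refresh moment of user $i$ closest to $t_1$. In words, a cycle time is the duration between two closest refresh moments of user $i$ during which every other user has successfully accessed the channel at least once. The channel cycle time is $\Psi = \frac1N\sum_{n=1}^N \mathbb{E}[\Gamma_n]$. Here $N=2$. *)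

(* Defs.v *)
From HB Require Import structures.
From mathcomp Require Import all_boot all_order all_algebra.
From mathcomp Require Import all_classical all_reals all_analysis.
Set Implicit Arguments. Unset Strict Implicit. Unset Printing Implicit Defensive.
Import Order.TTheory GRing.Theory Num.Theory.
Local Open Scope classical_set_scope.
Local Open Scope ring_scope.

(* Users: [true] = user A, [false] = user B (N = 2).
   A sample path [w : bool -> nat -> bool]: [w i k] = user i transmits in slot k.
   Slot k occupies the time interval [k*Tslot, (k+1)*Tslot]; moments are
   slot boundaries, the moment [m : nat] being time m*Tslot. *)

Section Channel.
Variable w : bool -> nat -> bool.

Definition success (n : bool) (k : nat) : bool := w n k && ~~ w (~~ n) k.

Definition M (n : bool) (m0 m1 : nat) : nat :=
  (\sum_(m0 <= k < m1) success n k)%N.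

Definition refresh (i : bool) (m : nat) : Prop :=
  exists k, [/\ m = k.+1, success i k &
    exists j, [/\ (k < j)%N, success (~~ i) j &
      forall l, (k < l < j)%N -> ~~ success i l && ~~ success (~~ i) l]].

Definition is_cycle (i : bool) (m0 m1 : nat) : Prop :=
  [/\ refresh i m0, refresh i m1, (m0 < m1)%N,
      (forall n, (0 < M n m0 m1)%N) &
      (forall m, (m0 < m < m1)%N -> ~ refresh i m)
      \/ (exists m', [/\ (m0 < m' < m1)%N, refresh i m',
            (forall m, (m' < m < m1)%N -> ~ refresh i m) &
            exists n, M n m0 m' = 0%N])].

Definition cycle_start (i : bool) (m0 : nat) : Prop := exists m1, is_cycle i m0 m1.

Definition kth_cycle (i : bool) (k m0 m1 : nat) : Prop :=
  is_cycle i m0 m1 /\ (\sum_(m < m0) `[< cycle_start i m >])%N = k.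

End Channel.

Definition cycle_time {R : realType} (Tslot : R) (w : bool -> nat -> bool)
    (i : bool) (k : nat) : \bar R :=
  match pselect (exists p : nat * nat, kth_cycle w i k p.1 p.2) with
  | left h => let p := proj1_sig (cid h) in (((p.2 - p.1)%:R * Tslot)%:E)%E
  | right _ => (+oo)%E
  end.

Definition mutually_independent {d} {T : measurableType d} {R : realType}
    (P : probability T R) (I : eqType) (E : I -> set T) : Prop :=
  forall s : seq I, uniq s ->
    P (\big[setI/setT]_(j <- s) E j) = (\prod_(j <- s) P (E j))%E.

(* channel cycle time Psi = (1/N) sum_n E[Gamma_n], N = 2, for the k-th cycles *)
Definition channel_cycle_time {d} {T : measurableType d} {R : realType}
    (P : probability T R) (tx : bool -> nat -> T -> bool) (Tslot : R) (k : nat)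
    : \bar R :=
  ((2^-1)%:E * ((\int[P]_x cycle_time Tslot (fun i s => tx i s x) true k)
             + (\int[P]_x cycle_time Tslot (fun i s => tx i s x) false k)))%E.

(* Main.v *)
(** Write [a] and [b] for the probabilities that a slot is a success of user [i],
    resp. of the other user. Between two refresh moments of [i] both users have
    succeeded, so with two users the cycles are exactly the gaps between
    consecutive refresh moments. Follow a path through its phases: from an even
    phase one waits for a success of [i], from an odd phase for a success of the
    other user. The phase is a pure birth chain, which spends an expected [1/a]
    slots in each even phase and [1/b] in each odd one. The number of refresh
    moments up to [m] is half the phase, plus one when the phase is odd and the
    next success belongs to the other user; the latter event is independent of
    the past. The [k]-th cycle thus consists of one even phase, the end of the
    odd phase before it and the beginning of the odd phase after it, of expected
    lengths [1/a], [beta / b] and [(1 - beta) / b]: the total is [1/a + 1/b],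
    whatever [beta] is. *)

Require Import Defs.
From HB Require Import structures.
From mathcomp Require Import all_boot all_order all_algebra.
From mathcomp Require Import all_classical all_reals all_analysis.
From mathcomp Require Import measurable_realfun.
From mathcomp Require Import zify ring lra.
Set Implicit Arguments. Unset Strict Implicit. Unset Printing Implicit Defensive.
Import Order.TTheory GRing.Theory Num.Theory.
Import numFieldNormedType.Exports.
Local Open Scope classical_set_scope.
Local Open Scope ring_scope.

(** * Cycles along a sample path *)

Section Path.
Variables (w : bool -> nat -> bool) (i : bool).

Fixpoint phase (m : nat) : nat :=
  if m is l.+1 then
    (phase l + (if odd (phase l) then success w (~~ i) l else success w i l))%N
  else 0%N.

(** The half of a refresh that lies in the future of the moment [m]; the other half is a success in
    the slot that ends at [m]. *)
Definition next_other (m : nat) : Prop :=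
  exists j, [/\ (m <= j)%N, success w (~~ i) j &
    forall l, (m <= l < j)%N -> ~~ success w i l && ~~ success w (~~ i) l].

Definition refresh_count (m : nat) : nat :=
  (\sum_(l < m.+1) `[< refresh w i l >])%N.

Lemma success_excl n m : success w n m -> ~~ success w (~~ n) m.
Proof. by rewrite /success negbK => /andP[-> /negbTE ->]. Qed.

Lemma refresh0 : ~ refresh w i 0.
Proof. by move=> [k []]. Qed.

Lemma refreshS m : refresh w i m.+1 <-> success w i m /\ next_other m.+1.
Proof.
split; first by move=> [k [[<-] sk nk]].
by move=> [sm nm]; exists m.
Qed.

Lemma next_other_step m :
  next_other m <-> success w (~~ i) m \/ (~~ success w i m /\ next_other m.+1).
Proof.
split.
- move=> [j [lmj sj none]].
  have [mj|] := ltnP m j; last first.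
    by move=> ljm; left; have -> : m = j by lia.
  right; have /none/andP[nm _] : (m <= m < j)%N by lia.
  by split=> //; exists j; split=> // l lj; apply: none; lia.
- move=> [sm|]; first by exists m; split=> // l; lia.
  move=> [nm [j [lmj sj none]]].
  have [som|nom] := boolP (success w (~~ i) m).
    by exists m; split=> // l; lia.
  exists j; split=> //; first lia.
  move=> l lj; have [->|lm] := eqVneq l m; first by rewrite nm nom.
  by apply: none; lia.
Qed.

(** Each even phase and the odd phase after it produce one refresh moment: the last success of [i]
    before the other user's. In an odd phase that success is already past exactly when the next
    success is the other user's. *)
Lemma refresh_countE m :
  refresh_count m = ((phase m)./2 + (odd (phase m) && `[< next_other m >]))%N.
Proof.
elim: m => [|m IH].
  by rewrite /refresh_count big_ord1 asboolF//; exact: refresh0.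
rewrite /refresh_count big_ord_recr /= -/(refresh_count m) IH.
rewrite (asbool_equiv_eq (next_other_step m)) (asbool_equiv_eq (refreshS m)).
rewrite asbool_and asbool_or asbool_and !asboolb.
have := @success_excl i m; case: (success w i m) => [/(_ isT)/negbTE->|_] /=.
  rewrite andbF addn0; case: ifPn => od; first by rewrite addn0 od.
  by rewrite addn1 /= uphalf_half (negbTE od).
case: (success w (~~ i) m) => /=; last by rewrite if_same !addn0.
case: ifPn => od; last by rewrite [(phase m + _)%N]addn0 (negbTE od) /= !addn0.
by rewrite [(phase m + _)%N]addn1 /= od uphalf_half od /= !addn0 addn1 add1n.
Qed.

Lemma refresh_M_gt0 m0 m1 n : refresh w i m0 -> refresh w i m1 -> (m0 < m1)%N ->
  (0 < M w n m0 m1)%N.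
Proof.
move=> r0 + lt01; case: m1 lt01 => // m1 lt01 /refreshS[s1 _].
case: r0 => k [e0 _ [j [kj sj none]]].
have M_gt0 u l : (m0 <= l < m1.+1)%N -> success w u l -> (0 < M w u m0 m1.+1)%N.
  by move=> lin su; rewrite /M (big_rem l) ?mem_index_iota //= su.
have [->|ni] := eqVneq n i; first by apply: (M_gt0 i m1) => //; lia.
have -> : n = ~~ i by move: ni; case: n; case: i.
(* The other user's slot [j] comes before slot [m1]: otherwise the success of [i] in slot [m1] would
   fall in the gap before [j]. *)
apply: (M_gt0 _ j) => //; apply/andP; split; first lia.
rewrite ltnS leqNgt; apply/negP => m1j.
have /none/andP[] : (k < m1 < j)%N by lia.
by rewrite s1.
Qed.

(** By [refresh_M_gt0] no count vanishes between two refresh moments, so non-consecutive ones never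
    form a cycle. *)
Lemma is_cycleE m0 m1 : is_cycle w i m0 m1 <->
  [/\ refresh w i m0, refresh w i m1, (m0 < m1)%N &
      forall m, (m0 < m < m1)%N -> ~ refresh w i m].
Proof.
split=> [[r0 r1 lt01 _ [//|[m' [/andP[m0' _] r' _ [n Mn0]]]]]|[r0 r1 lt01 none]].
  by have := refresh_M_gt0 n r0 r' m0'; rewrite Mn0.
by split=> // [n|]; [exact: refresh_M_gt0 | left].
Qed.

Lemma cycle_startE m m1 : refresh w i m1 -> (m < m1)%N ->
  cycle_start w i m <-> refresh w i m.
Proof.
move=> r1 lt1; split; first by case=> m2 /is_cycleE[].
move=> r; have ex : exists n, (m < n)%N && `[< refresh w i n >].
  by exists m1; rewrite lt1; exact/asboolP.
case: (ex_minnP ex) => m2 /andP[lt2 /asboolP r2] min2.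
exists m2; apply/is_cycleE; split=> // l /andP[ml lm2] rl.
have : (m2 <= l)%N by apply: min2; rewrite ml; exact/asboolP.
lia.
Qed.

Lemma refresh_countS m :
  refresh_count m.+1 = (refresh_count m + `[< refresh w i m.+1 >])%N.
Proof. by rewrite /refresh_count big_ord_recr. Qed.

Lemma refresh_count0 : refresh_count 0 = 0%N.
Proof. by rewrite refresh_countE. Qed.

Lemma leq_refresh_count m n : (m <= n)%N -> (refresh_count m <= refresh_count n)%N.
Proof.
move=> /subnKC <-; elim: (n - m)%N => [|l IH]; first by rewrite addn0.
by rewrite addnS refresh_countS; lia.
Qed.

Lemma refresh_count_lt m n : (m < n)%N -> refresh w i n ->
  (refresh_count m < refresh_count n)%N.
Proof.
case: n => // n; rewrite ltnS => /leq_refresh_count lemn rn.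
by rewrite refresh_countS asboolT// addn1 ltnS.
Qed.

Lemma refresh_count_const m n : (m <= n)%N ->
  (forall l, (m < l <= n)%N -> ~ refresh w i l) ->
  refresh_count n = refresh_count m.
Proof.
elim: n => [|n IH]; first by rewrite leqn0 => /eqP ->.
rewrite leq_eqVlt ltnS => /predU1P[->//|lemn none].
rewrite refresh_countS asboolF ?addn0; last by apply: none; lia.
by apply: IH => // l lin; apply: none; lia.
Qed.

(** Every refresh moment before [m] starts a cycle, since a later one exists; the extra unit is [m]
    itself. *)
Lemma cycle_start_count m : refresh w i m ->
  refresh_count m = (\sum_(l < m) `[< cycle_start w i l >]).+1.
Proof.
move=> r; rewrite /refresh_count big_ord_recr /= asboolT// addn1; congr _.+1.
by apply: eq_bigr => l _; rewrite (asbool_equiv_eq (cycle_startE r (ltn_ord l))).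
Qed.

(** Cycles are numbered from 0, so the [k]-th one opens at refresh moment number [k.+1], and the
    monotone count keeps this value until the next refresh. The length of a cycle becomes the size
    of a level set. *)
Lemma kth_cycle_count k m0 m1 : kth_cycle w i k m0 m1 ->
  forall m, (refresh_count m == k.+1) = (m0 <= m < m1)%N.
Proof.
move=> [/is_cycleE[r0 r1 lt01 none] ck] m.
have c0 : refresh_count m0 = k.+1 by rewrite cycle_start_count// ck.
have [lt0|le0] := ltnP m m0.
  by apply/eqP => cm; have := refresh_count_lt lt0 r0; lia.
have [lt1|le1] /= := ltnP m m1.
  rewrite -c0; apply/eqP/refresh_count_const => // l lin.
  by apply: none; lia.
apply/eqP => cm.
by have := refresh_count_lt lt01 r1; have := leq_refresh_count le1; lia.
Qed.

(** The count starts at 0 and grows by at most one per slot, so it skips no value. *)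
Lemma refresh_count_first k m : (k < refresh_count m)%N ->
  exists n, [/\ refresh w i n, refresh_count n = k.+1 &
    forall l, (l < n)%N -> (refresh_count l <= k)%N].
Proof.
move=> ltkm; have ex : exists m, (k < refresh_count m)%N by exists m.
case: (ex_minnP ex) => -[|n] ltkn minn; first by rewrite refresh_count0 in ltkn.
have len : (refresh_count n <= k)%N.
  by rewrite leqNgt; apply/negP => /minn; rewrite ltnn.
exists n.+1; move: ltkn; rewrite refresh_countS.
case: asboolP => [rn|_] ltkn; last lia.
split=> //; first lia.
by move=> l; rewrite ltnS => /leq_refresh_count; lia.
Qed.

Lemma kth_cycle_exP k :
  (exists p : nat * nat, kth_cycle w i k p.1 p.2) <->
  (exists m, refresh_count m = k.+2).
Proof.
split=> [[[m0 m1] /= [/is_cycleE[r0 r1 lt01 _] ck]]|[m cm]].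
  have [|m [_ cm _]] := @refresh_count_first k.+1 m1; last by exists m.
  by rewrite -ck -cycle_start_count//; exact: refresh_count_lt.
have [|m1 [r1 c1 min1]] := @refresh_count_first k.+1 m; first by rewrite cm.
have [|m0 [r0 c0 min0]] := @refresh_count_first k m; first by rewrite cm.
have lt01 : (m0 < m1)%N.
  by rewrite ltnNge; apply/negP => /leq_refresh_count; lia.
exists (m0, m1); split=> /=; last first.
  by apply/eqP; rewrite -eqSS -cycle_start_count// c0.
apply/is_cycleE; split=> // l /andP[l0 l1] rl.
by have := refresh_count_lt l0 rl; have := min1 _ l1; lia.
Qed.

End Path.

(** * The cycle time as a series of indicators *)

Section CycleTime.
Variables (R : realType) (w : bool -> nat -> bool) (i : bool) (Tslot : R).
Hypothesis Tslot_gt0 : 0 < Tslot.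

(** Vacuous for every [m] on paths without a [k]-th cycle: there [cycle_time] is
    [+oo], and so is the series of [cycle_time_series]. *)
Definition in_cycle (k m : nat) : Prop :=
  (exists n, refresh_count w i n = k.+2) -> refresh_count w i m = k.+1.

Lemma cycle_time_series k :
  cycle_time Tslot w i k = (\sum_(m <oo) (Tslot * `[< in_cycle k m >]%:R)%:E)%E.
Proof.
rewrite /cycle_time; case: pselect => [h|noh].
  case: (cid h) => -[m0 m1] /= kc.
  have ex : exists n, refresh_count w i n = k.+2.
    by apply/kth_cycle_exP; exists (m0, m1).
  have inE m : `[< in_cycle k m >] = (m0 <= m < m1)%N.
    rewrite -(kth_cycle_count kc); apply/asboolP/eqP; first exact.
    by move=> cm _.
  (* All terms from [m1] on vanish, which leaves a finite sum counting the slots from [m0] to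
     [m1]. *)
  rewrite (@nneseries_split _ _ 0%N m1); last first.
    by move=> m _; rewrite lee_fin mulr_ge0// ltW.
  rewrite add0n eseries0 ?adde0; last first.
    move=> m ltm _; rewrite inE (_ : (m0 <= m < m1)%N = false) ?mulr0//.
    by lia.
  rewrite sumEFin -mulr_sumr mulrC; congr ((_ * _)%:E).
  under eq_bigr do rewrite inE.
  rewrite -natr_sum; congr (_%:R).
  have lt01 : (m0 < m1)%N by case: kc => -[].
  rewrite (@big_cat_nat _ _ _ m0) ?(ltnW lt01)//=.
  rewrite big_nat big1 ?add0n; last by move=> m; lia.
  rewrite big_nat (eq_bigr (fun=> 1%N)); last by move=> m ->.
  by rewrite -big_nat sum_nat_const_nat muln1.
have noex : ~ exists n, refresh_count w i n = k.+2.
  by move=> /kth_cycle_exP.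
have inT m : `[< in_cycle k m >] = true by apply/asboolP => /noex.
under eq_eseriesr do rewrite inT mulr1.
apply/esym/eqyP => A A0.
(* Every term equals [Tslot], so [n] terms exceed the arbitrary bound [A]. *)
have [n ltAn] : exists n : nat, A / Tslot <= n%:R.
  by exists (Num.truncn (A / Tslot)).+1; apply/ltW/truncnS_gt.
apply: le_trans (nneseries_lim_ge n _) => [|m _ _]; last first.
  by rewrite lee_fin ltW.
rewrite sumEFin lee_fin sumr_const_nat subn0 -mulr_natl.
by rewrite -ler_pdivrMr.
Qed.

End CycleTime.

(** * Expected sojourn times of a pure birth chain *)

Section Series.
Variable R : realType.

(** The balance bounds the partial sums by [rho^-1], so the series converges; hence [f] tends to 0,
    and the balance then gives the limit. *)
Lemma series_cvg_of_balance (rho : R) (f g : nat -> R) :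
  0 < rho -> (forall n, 0 <= f n) -> (forall n, g n <= 1) ->
  g @ \oo --> (1 : R) -> (forall n, rho * series f n = g n - f n) ->
  series f @ \oo --> rho^-1.
Proof.
move=> rho0 f0 g1 gcvg bal.
have fE n : series f n = rho^-1 * (g n - f n).
  by rewrite -bal mulKf ?gt_eqF.
have cf : cvgn (series f).
  apply: nondecreasing_is_cvgn; first exact: nondecreasing_series.
  exists rho^-1 => _ [n _ <-]; rewrite fE ler_piMr ?invr_ge0 ?(ltW rho0)//.
  by have := f0 n; have := g1 n; lra.
rewrite (_ : series f = fun n => rho^-1 * (g n - f n)); last exact/funext.
rewrite -[X in _ --> X]mulr1 -[X in _ * X]subr0.
apply: cvgM; first exact: cvg_cst.
by apply: cvgB => //; exact: cvg_series_cvg_0.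
Qed.

(** [q j n] is the mass in state [j] at time [n]. Summed over time, the recursion telescopes:
    outflow from [j.+1] is inflow from [j] minus the mass still present. By induction the inflow
    tends to 1. *)
Lemma pure_birth_series (rho : nat -> R) (q : nat -> nat -> R) :
  (forall j, 0 < rho j) -> (forall j n, 0 <= q j n) ->
  q 0%N 0%N = 1 -> (forall j, q j.+1 0%N = 0) ->
  (forall n, q 0%N n.+1 = q 0%N n * (1 - rho 0%N)) ->
  (forall j n, q j.+1 n.+1 = q j.+1 n * (1 - rho j.+1) + q j n * rho j) ->
  forall j, series (q j) @ \oo --> (rho j)^-1.
Proof.
move=> rho0 q0 q00 qj0 q0S qS j.
have bal0 n : rho 0%N * series (q 0%N) n = 1 - q 0%N n.
  elim: n => [|n IH]; first by rewrite seriesEnat /= big_geq// mulr0 q00 subrr.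
  by rewrite seriesEnat /= big_nat_recr//= mulrDr IH q0S; ring.
have balS l n : rho l.+1 * series (q l.+1) n = rho l * series (q l) n - q l.+1 n.
  elim: n => [|n IH].
    by rewrite !seriesEnat /= !big_geq// !mulr0 qj0 subrr.
  rewrite !seriesEnat /= !big_nat_recr//= !mulrDr IH qS seriesEnat /=; ring.
have le1 l n : rho l * series (q l) n <= 1.
  elim: l => [|l IH]; first by rewrite bal0; have := q0 0%N n; lra.
  by rewrite balS; have := q0 l.+1 n; lra.
elim: j => [|j IH]; first by apply: (series_cvg_of_balance _ _ _ _ bal0) => //; exact: cvg_cst.
apply: (series_cvg_of_balance _ _ _ _ (balS j)) => //.
by rewrite -(mulfV (lt0r_neq0 (rho0 j))); apply: cvgM => //; exact: cvg_cst.
Qed.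

Lemma eq0_of_geometric_bound (c x K : R) : 0 <= c < 1 ->
  (forall n, `|x| <= K * c ^+ n) -> x = 0.
Proof.
move=> /andP[c0 c1] xle; apply/normr0_eq0/le_anti; rewrite normr_ge0 andbT.
have cvgK : K * c ^+ n @[n --> \oo] --> 0.
  by apply: cvg_geometric; rewrite ger0_norm.
by apply: (cvgr_to_ge cvgK); exact: nearW.
Qed.

End Series.

(** * Events and expectations *)

Section Events.
Variables (R : realType) (d : measure_display) (T : measurableType d).
Variables (P : probability T R) (tx : bool -> nat -> T -> bool) (p : bool -> R).
Hypothesis p_bounds : forall n, 0 < p n < 1.
Hypothesis mtx : forall n k, measurable [set x | tx n k x].
Hypothesis Ptx : forall n k, P [set x | tx n k x] = (p n)%:E.
Hypothesis indep :
  mutually_independent P (fun nk : bool * nat => [set x | tx nk.1 nk.2 x]).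

Definition Pr (E : set T) : R := fine (P E).

Lemma Pr_EFin E : measurable E -> P E = (Pr E)%:E.
Proof. by move=> mE; rewrite /Pr fineK// fin_num_measure. Qed.

Lemma Pr_ge0 E : 0 <= Pr E.
Proof. by rewrite fine_ge0. Qed.

Lemma PrU E F : measurable E -> measurable F -> E `&` F = set0 ->
  Pr (E `|` F) = Pr E + Pr F.
Proof.
move=> mE mF EF; apply: EFin_inj.
by rewrite EFinD -!Pr_EFin//; [exact: measureU | exact: measurableU].
Qed.

Lemma PrD E F : measurable E -> measurable F -> F `<=` E ->
  Pr (E `\` F) = Pr E - Pr F.
Proof.
move=> mE mF FE; apply/esym/eqP; rewrite subr_eq -PrU//.
- by rewrite setUC setDUK.
- exact: measurableD.
- by rewrite setDE -setIA setICl setI0.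
Qed.

Lemma Pr_le E F : measurable E -> measurable F -> E `<=` F -> Pr E <= Pr F.
Proof. by move=> mE mF EF; rewrite -subr_ge0 -PrD// Pr_ge0. Qed.

Lemma Pr_setT : Pr setT = 1.
Proof. by rewrite /Pr probability_setT. Qed.

Lemma Pr_set0 : Pr set0 = 0.
Proof. by rewrite /Pr measure0. Qed.

(** Only transmissions occur, no silences: these are the events whose product rule [indep]
    provides. *)
Definition all_tx (s : seq (bool * nat)) : set T :=
  \big[setI/setT]_(nk <- s) [set x | tx nk.1 nk.2 x].

Lemma all_tx_measurable s : measurable (all_tx s).
Proof. by apply: bigsetI_measurable => nk _. Qed.
Hint Resolve all_tx_measurable : core.

(** Stands for "[E] is determined by the slots before [m]". The events with this
    independence property are closed under the few operations used to build the
    phases, which avoids generated sigma-algebras. *)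
Definition before (m : nat) (E : set T) : Prop := measurable E /\
  forall s, uniq s -> all (fun nk => m <= nk.2)%N s ->
    Pr (E `&` all_tx s) = Pr E * \prod_(nk <- s) p nk.1.

Lemma beforeT m : before m setT.
Proof.
split=> // s us _; rewrite setTI Pr_setT mul1r.
by rewrite /Pr [P _](indep us) (eq_bigr (fun nk => (p nk.1)%:E)) ?prodEFin// => nk _.
Qed.

Lemma before0 m : before m set0.
Proof. by split=> // s _ _; rewrite set0I Pr_set0 mul0r. Qed.

Lemma before_leq m n E : (m <= n)%N -> before m E -> before n E.
Proof.
move=> mn [mE bE]; split=> // s us sn; apply: bE => //.
by apply: sub_all sn => nk; apply: leq_trans.
Qed.

Lemma beforeD m E F : F `<=` E -> before m E -> before m F -> before m (E `\` F).
Proof.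
move=> FE [mE bE] [mF bF]; split=> [|s us sm]; first exact: measurableD.
rewrite setIDAC (_ : _ `&` (_ `\` F) = (E `&` all_tx s) `\` (F `&` all_tx s)); last first.
  by apply/seteqP; split=> x /=; tauto.
rewrite !PrD ?bE ?bF ?mulrBl//; try exact: measurableI.
exact: setSI.
Qed.

Lemma beforeU m E F : E `&` F = set0 -> before m E -> before m F ->
  before m (E `|` F).
Proof.
move=> EF [mE bE] [mF bF]; split=> [|s us sm]; first exact: measurableU.
rewrite setIUl !PrU ?bE ?bF ?mulrDl//; try exact: measurableI.
by rewrite setIACA EF set0I.
Qed.

(** * Success in one slot *)

Definition path_of (x : T) : bool -> nat -> bool := fun n k => tx n k x.

Definition succ_ev (n : bool) (m : nat) : set T :=
  [set x | success (path_of x) n m].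

Definition p_succ (n : bool) : R := p n * (1 - p (~~ n)).

Lemma p_succ_gt0 n : 0 < p_succ n.
Proof.
by have := p_bounds n; have := p_bounds (~~ n); rewrite /p_succ; nra.
Qed.

Lemma p_succ_sum n : p_succ n + p_succ (~~ n) < 1.
Proof.
by have := p_bounds n; have := p_bounds (~~ n); rewrite /p_succ negbK; nra.
Qed.

Lemma succ_evE n m :
  succ_ev n m = [set x | tx n m x] `\` [set x | tx (~~ n) m x].
Proof.
apply/seteqP; split=> x /=; rewrite /succ_ev /success /path_of /=.
  by move=> /andP[-> /negP].
by move=> [-> /negP].
Qed.

Lemma succ_ev_measurable n m : measurable (succ_ev n m).
Proof. by rewrite succ_evE; apply: measurableD. Qed.
Hint Resolve succ_ev_measurable : core.

Lemma succ_ev_disj n m : succ_ev n m `&` succ_ev (~~ n) m = set0.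
Proof.
by apply/seteqP; split=> x //= -[] sn /(success_excl); rewrite negbK sn.
Qed.

Lemma Pr_before_succ_all n m E s : before m E -> uniq s ->
  all (fun nk => m < nk.2)%N s ->
  Pr (E `&` succ_ev n m `&` all_tx s) =
  Pr E * p_succ n * \prod_(nk <- s) p nk.1.
Proof.
move=> [mE bE] us sm.
have nin b : (b, m) \notin s.
  by apply/negP => /(allP sm); rewrite ltnn.
have sm' : all (fun nk => m <= nk.2)%N s by apply: sub_all sm => nk /ltnW.
(* A success of [n] is the event that [n] transmits minus the event that both do, and each has a
   product rule. *)
pose s1 := (n, m) :: s; pose s2 := (n, m) :: (~~ n, m) :: s.
have -> : E `&` succ_ev n m `&` all_tx s =
    (E `&` all_tx s1) `\` (E `&` all_tx s2).
  rewrite succ_evE /s1 /s2 /all_tx !big_cons.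
  by apply/seteqP; split=> x /=; tauto.
rewrite PrD; try exact: measurableI; last first.
  rewrite /s1 /s2 /all_tx !big_cons => x /=; tauto.
rewrite !bE /s1 /s2 /= ?leqnn ?nin ?us ?sm' //=; last first.
  by rewrite inE negb_or nin andbT xpair_eqE; case: (n).
by rewrite !big_cons /= /p_succ; ring.
Qed.

Lemma Pr_before_succ n m E : before m E -> Pr (E `&` succ_ev n m) = Pr E * p_succ n.
Proof.
move=> bE; have := @Pr_before_succ_all n m E [::] bE erefl erefl.
by rewrite /all_tx !big_nil setIT mulr1.
Qed.

Lemma before_succ n m E : before m E -> before m.+1 (E `&` succ_ev n m).
Proof.
move=> bE; split=> [|s us sm]; first by apply: measurableI => //; case: bE.
by rewrite Pr_before_succ_all// Pr_before_succ.
Qed.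

(** * Distribution of the phase *)

Variable i : bool.

(** A subset of [E] is removed, as [beforeD] and [PrD] require. *)
Definition wait_ev (E : set T) (n : bool) (m : nat) := E `\` (E `&` succ_ev n m).

Lemma before_wait n m E : before m E -> before m.+1 (wait_ev E n m).
Proof.
move=> bE; apply: beforeD; [exact: subIsetl | exact: before_leq bE|].
exact: before_succ.
Qed.

Lemma Pr_wait n m E : before m E -> Pr (wait_ev E n m) = Pr E * (1 - p_succ n).
Proof.
move=> bE; have mE := bE.1; rewrite PrD//; last exact: measurableI.
by rewrite Pr_before_succ//; ring.
Qed.

Definition phase_ev (j m : nat) : set T := [set x | phase (path_of x) i m = j].

(** The user whose success ends phase [j]. *)
Definition phase_user (j : nat) : bool := if odd j then ~~ i else i.

Lemma phase_ev00 : phase_ev 0 0 = setT.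
Proof. by apply/seteqP; split. Qed.

Lemma phase_evS0 j : phase_ev j.+1 0 = set0.
Proof. by apply/seteqP; split. Qed.

Lemma phase_ev0S m : phase_ev 0 m.+1 = wait_ev (phase_ev 0 m) i m.
Proof.
apply/seteqP; split=> x /=; rewrite /phase_ev /wait_ev /succ_ev /=.
  move=> /eqP; rewrite addn_eq0 => /andP[/eqP -> /=].
  by case: success => // _; split=> // -[].
by move=> [-> /= nand]; case: success nand => // -[].
Qed.

Lemma phase_evSS j m : phase_ev j.+1 m.+1 =
  wait_ev (phase_ev j.+1 m) (phase_user j.+1) m
  `|` (phase_ev j m `&` succ_ev (phase_user j) m).
Proof.
have stepE x : phase (path_of x) i m.+1 = (phase (path_of x) i m +
    success (path_of x) (phase_user (phase (path_of x) i m)) m)%N.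
  by rewrite /phase_user /=; case: ifP.
apply/seteqP; split=> x; rewrite /wait_ev /phase_ev /succ_ev /setU /setI /setD /mkset;
  rewrite stepE.
- case sE: (success _ _ m) => /=.
    by rewrite addn1 => -[phE]; right; rewrite -phE.
  rewrite addn0 => phE; left; split=> // -[_].
  by rewrite -phE sE.
- move=> [[-> ns]|[-> ->]]; last by rewrite addn1.
  by case: success ns => [[]//|_]; rewrite addn0.
Qed.

Lemma phase_evSS_disj j m : wait_ev (phase_ev j.+1 m) (phase_user j.+1) m
  `&` (phase_ev j m `&` succ_ev (phase_user j) m) = set0.
Proof.
apply/seteqP; split=> x //; rewrite /wait_ev /phase_ev /=.
by move=> [[-> _] [/eqP]]; rewrite (gtn_eqF (ltnSn j)).
Qed.

Lemma before_phase j m : before m (phase_ev j m).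
Proof.
elim: m j => [[|j]|m IH [|j]].
- by rewrite phase_ev00; exact: beforeT.
- by rewrite phase_evS0; exact: before0.
- by rewrite phase_ev0S; exact: before_wait.
- rewrite phase_evSS; apply: beforeU; first exact: phase_evSS_disj.
    exact: before_wait.
  exact: before_succ.
Qed.

Lemma phase_ev_measurable j m : measurable (phase_ev j m).
Proof. by case: (before_phase j m). Qed.
Hint Resolve phase_ev_measurable : core.

Definition rho (j : nat) : R := p_succ (phase_user j).

Lemma phase_series j : series (fun m => Pr (phase_ev j m)) @ \oo --> (rho j)^-1.
Proof.
apply: (pure_birth_series (rho := rho) (q := fun j m => Pr (phase_ev j m))).
- by move=> l; exact: p_succ_gt0.
- by move=> l n; exact: Pr_ge0.
- by rewrite phase_ev00 Pr_setT.
- by move=> l; rewrite phase_evS0 Pr_set0.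
- by move=> n; rewrite phase_ev0S Pr_wait//; exact: before_phase.
- move=> l n; have bl := before_phase l n; have bS := before_phase l.+1 n.
  rewrite phase_evSS PrU ?Pr_wait ?Pr_before_succ//.
  + by case: (before_wait (phase_user l.+1) bS).
  + by case: (before_succ (phase_user l) bl).
  + exact: phase_evSS_disj.
Qed.

(** * The owner of the next success *)

Definition next_other_ev (m : nat) : set T := [set x | next_other (path_of x) i m].

Lemma next_other_ev_measurable m : measurable (next_other_ev m).
Proof.
(* Quantifiers become countable operations; [set0] and [setT] are the neutral values at excluded
   indices. *)
have -> : next_other_ev m = \bigcup_j (if (m <= j)%N then
    succ_ev (~~ i) j `&` \bigcap_l (if (m <= l < j)%N then
      ~` succ_ev i l `&` ~` succ_ev (~~ i) l else setT) else set0).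
  apply/seteqP; split=> x.
    move=> [j [mj sj none]]; exists j => //; rewrite mj; split=> // l _.
    by case: ifPn => // /none/andP[/negP ? /negP ?].
  move=> [j _]; case: ifPn => // mj [sj none]; exists j; split=> // l lj.
  by have := none l I; rewrite lj => -[/negP -> /negP ->].
apply: bigcupT_measurable => j; case: ifPn => // _; apply: measurableI => //.
apply: bigcapT_measurable => l; case: ifPn => // _.
by apply: measurableI; exact: measurableC.
Qed.
Hint Resolve next_other_ev_measurable : core.

(** The [beta] of the overview: the chance that the other user succeeds first. *)
Definition p_other : R := p_succ (~~ i) / (p_succ i + p_succ (~~ i)).

Lemma Pr_next_other m E : before m E -> Pr (E `&` next_other_ev m) = Pr E * p_other.
Proof.
move=> bE; apply/eqP; rewrite -subr_eq0; apply/eqP.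
set a := p_succ i; set b := p_succ (~~ i).
have a0 : 0 < a by exact: p_succ_gt0.
have b0 : 0 < b by exact: p_succ_gt0.
have ab1 : a + b < 1 by exact: p_succ_sum.
have po01 : 0 <= p_other <= 1.
  by rewrite /p_other divr_ge0 ?ler_pdivrMr -/a -/b; lra.
apply: (@eq0_of_geometric_bound _ (1 - (a + b)) _ (Pr E)); first lra.
(* Conditioning on slot [m] multiplies the discrepancy by [1 - (a + b)], the
   probability that nobody succeeds. *)
move=> n; elim: n m E bE => [|n IH] m E bE; have mE := bE.1.
  rewrite expr0 mulr1 ler_norml.
  have le1 : Pr (E `&` next_other_ev m) <= Pr E.
    by apply: Pr_le => //; exact: measurableI.
  have := Pr_ge0 (E `&` next_other_ev m); have := Pr_ge0 E; nra.
(* [E'] says that nobody succeeds in slot [m]; it is reached by two differences so that [before] is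
   preserved. *)
pose E1 := wait_ev E i m; pose E' := E1 `\` (E `&` succ_ev (~~ i) m).
have bE1 : before m.+1 E1 by exact: before_wait.
have bEo : before m.+1 (E `&` succ_ev (~~ i) m) by exact: before_succ.
have subE1 : E `&` succ_ev (~~ i) m `<=` E1.
  move=> x [Ex so]; split=> // -[_ si].
  by have : set0 x by rewrite -(succ_ev_disj i m).
have bE' : before m.+1 E' by exact: beforeD.
have PrE' : Pr E' = Pr E * (1 - (a + b)).
  rewrite PrD//; [|exact: bE1.1 | exact: bEo.1].
  by rewrite Pr_wait// Pr_before_succ// -/a -/b; ring.
have split_ev : E `&` next_other_ev m =
    (E `&` succ_ev (~~ i) m) `|` (E' `&` next_other_ev m.+1).
  apply/seteqP; split=> x.
    move=> [Ex /next_other_step[so|[/negP nsi nx]]]; first by left.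
    have [so|nso] := pselect (succ_ev (~~ i) m x); first by left.
    by right; split=> //; split=> [|[]//]; split=> // -[].
  move=> [[Ex so]|[[[Ex nsi] nso] nx]]; split=> //; apply/next_other_step.
    by left.
  by right; split=> //; apply/negP => si; apply: nsi.
have -> : Pr (E `&` next_other_ev m) - Pr E * p_other =
    Pr (E' `&` next_other_ev m.+1) - Pr E' * p_other.
  rewrite split_ev PrU//; first last.
  - by apply/seteqP; split=> x // -[so [[_ nso] _]].
  - by apply: measurableI => //; exact: bE'.1.
  - exact: bEo.1.
  (* [p_other] solves the first-step equation [beta = b + (1 - (a + b)) * beta]. *)
  rewrite Pr_before_succ// PrE' /p_other -/a -/b; field; lra.
by rewrite exprS mulrA -PrE'; exact: IH.
Qed.

(** * Distribution of the refresh count *)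

Definition count_ev (k m : nat) : set T :=
  [set x | refresh_count (path_of x) i m = k.+1].

(** Solves [refresh_countE] for the phase: [2k+2], or [2k+1] with its refresh already past, or
    [2k+3] with its refresh still to come. *)
Lemma count_evE k m : count_ev k m =
  phase_ev k.+1.*2 m
  `|` (phase_ev k.*2.+1 m `&` next_other_ev m)
  `|` (phase_ev k.+1.*2.+1 m `\` (phase_ev k.+1.*2.+1 m `&` next_other_ev m)).
Proof.
apply/seteqP; split=> x; rewrite /count_ev /phase_ev /next_other_ev /=
  refresh_countE; case: asboolP => nx.
- have [od|ev] := boolP (odd (phase (path_of x) i m)) => /= ck.
    by left; right; split=> //; lia.
  by left; left; lia.
- rewrite andbF addn0 => ck.
  have [od|ev] := boolP (odd (phase (path_of x) i m)).
    by right; split=> [|[]//]; lia.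
  by left; left; lia.
- move=> [[->|[-> _]]|[phE nand]].
  + by rewrite /= odd_double/= doubleK; lia.
  + by rewrite /= odd_double/= uphalf_double; lia.
  + by exfalso; exact: nand.
- move=> [[->|[_ //]]|[-> _]]; rewrite andbF addn0 ?doubleK//.
  by rewrite /= uphalf_double.
Qed.

Lemma count_ev_measurable k m : measurable (count_ev k m).
Proof.
rewrite count_evE; apply: measurableU.
  by apply: measurableU => //; exact: measurableI.
by apply: measurableD => //; exact: measurableI.
Qed.
Hint Resolve count_ev_measurable : core.

Lemma Pr_count_ev k m : Pr (count_ev k m) =
  Pr (phase_ev k.+1.*2 m) + Pr (phase_ev k.*2.+1 m) * p_other
  + Pr (phase_ev k.+1.*2.+1 m) * (1 - p_other).
Proof.
have mI j : measurable (phase_ev j m `&` next_other_ev m) by exact: measurableI.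
have disj j l : j <> l -> phase_ev j m `&` phase_ev l m = set0.
  by move=> jl; apply/seteqP; split=> x //= [xj xl]; apply: jl; rewrite -xj.
have disjS j l A B : j <> l ->
    (phase_ev j m `&` A) `&` (phase_ev l m `&` B) = set0.
  by move=> jl; rewrite setIACA disj// set0I.
rewrite count_evE PrU ?PrU ?PrD ?Pr_next_other//; first by ring.
- exact: before_phase.
- exact: before_phase.
- by rewrite setIA disj ?set0I//; lia.
- by apply: measurableU.
- by apply: measurableD.
- rewrite setIUl setDE setIA disj; last by lia.
  by rewrite set0I set0U disjS//; lia.
Qed.

Lemma count_ev_series k :
  series (fun m => Pr (count_ev k m)) @ \oo --> (p_succ i)^-1 + (p_succ (~~ i))^-1.
Proof.
(* One summand per piece of [count_evE]; the shares of the two odd phases add up to one full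
   sojourn. *)
have -> : (p_succ i)^-1 + (p_succ (~~ i))^-1 =
    (p_succ i)^-1 + (p_succ (~~ i))^-1 * p_other
    + (p_succ (~~ i))^-1 * (1 - p_other) by ring.
have cvgP j : series (fun m => Pr (phase_ev j m)) @ \oo -->
    if odd j then (p_succ (~~ i))^-1 else (p_succ i)^-1.
  by have := @phase_series j; rewrite /rho /phase_user; case: odd.
rewrite (_ : series _ = fun n => series (fun m => Pr (phase_ev k.+1.*2 m)) n
    + series (fun m => Pr (phase_ev k.*2.+1 m)) n * p_other
    + series (fun m => Pr (phase_ev k.+1.*2.+1 m)) n * (1 - p_other)); last first.
  apply/funext => n; rewrite !seriesEnat /= !mulr_suml -!big_split /=.
  by apply: eq_bigr => m _; exact: Pr_count_ev.
apply: cvgD.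
  apply: cvgD; first by have := cvgP k.+1.*2; rewrite odd_double.
  apply: cvgM; last exact: cvg_cst.
  by have := cvgP k.*2.+1; rewrite /= odd_double.
apply: cvgM; last exact: cvg_cst.
by have := cvgP k.+1.*2.+1; rewrite /= odd_double.
Qed.

(** * Almost sure existence of cycles and their expected length *)

Definition reach_ev (k : nat) : set T := \bigcup_n count_ev k.+1 n.

Lemma reach_ev_measurable k : measurable (reach_ev k).
Proof. exact: bigcupT_measurable. Qed.
Hint Resolve reach_ev_measurable : core.

(** Convergent sojourn series force the probability of each phase to 0, hence also that of a phase
    below a fixed [J]. A path that never reaches the count [k.+2] keeps its phase below [k.+2.*2]
    forever. *)
Lemma Pr_not_reach k : Pr (~` reach_ev k) = 0.
Proof.
pose low J m : set T := [set x | (phase (path_of x) i m < J)%N].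
have lowS J m : low J.+1 m = low J m `|` phase_ev J m.
  by apply/seteqP; split=> x; rewrite /low /phase_ev /=; lia.
have low0 m : low 0 m = set0 by apply/seteqP; split.
have mlow J m : measurable (low J m).
  elim: J => [|J IH]; first by rewrite low0.
  by rewrite lowS; exact: measurableU.
have low_cvg J : Pr (low J m) @[m --> \oo] --> 0.
  elim: J => [|J IH].
    rewrite (_ : (fun m => _) = fun=> 0); first exact: cvg_cst.
    by apply/funext => m; rewrite low0 Pr_set0.
  rewrite (_ : (fun m => _) = fun m => Pr (low J m) + Pr (phase_ev J m)).
    rewrite -[X in _ --> X](addr0 0); apply: cvgD => //.
    by apply: cvg_series_cvg_0; apply/cvgP; exact: phase_series.
  apply/funext => m; rewrite lowS PrU//.
  by apply/seteqP; split=> x //; rewrite /low /phase_ev /= => -[lt e]; exfalso; lia.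
apply/le_anti; rewrite Pr_ge0 andbT.
apply: (cvgr_to_ge (low_cvg k.+2.*2)); apply: nearW => m.
apply: Pr_le => //; first exact: measurableC.
move=> x nreach; rewrite /low /= ltnNge; apply/negP => lephase.
have [|n [_ cn _]] := @refresh_count_first (path_of x) i k.+1 m.
  by rewrite refresh_countE; lia.
by apply: nreach; exists n.
Qed.

Definition cycle_ev (k m : nat) : set T := [set x | in_cycle (path_of x) i k m].

Lemma cycle_evE k m :
  cycle_ev k m = count_ev k m `|` (~` reach_ev k `\` count_ev k m).
Proof.
apply/seteqP; split=> x.
  move=> inc; have [cm|ncm] := pselect (count_ev k m x); first by left.
  by right; split=> // -[n _ cn]; apply: ncm; apply: inc; exists n.
by move=> [cm _ //|[nr _] [n cn]]; case: nr; exists n.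
Qed.

Lemma cycle_ev_measurable k m : measurable (cycle_ev k m).
Proof.
rewrite cycle_evE; apply: measurableU => //; apply: measurableD => //.
exact: measurableC.
Qed.
Hint Resolve cycle_ev_measurable : core.

(** The two events differ only on paths without a [k]-th cycle, a null set. *)
Lemma Pr_cycle_ev k m : Pr (cycle_ev k m) = Pr (count_ev k m).
Proof.
have mC : measurable (~` reach_ev k) by exact: measurableC.
have mD : measurable (~` reach_ev k `\` count_ev k m) by exact: measurableD.
rewrite cycle_evE PrU//; last by rewrite setDE setICA setICr setI0.
rewrite [X in _ + X](_ : _ = 0) ?addr0//.
by apply/le_anti; rewrite Pr_ge0 andbT -(Pr_not_reach k) Pr_le.
Qed.

Lemma integral_cycle_time (Tslot : R) k : 0 < Tslot ->
  (\int[P]_x cycle_time Tslot (path_of x) i k)%E =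
  (Tslot * ((p_succ i)^-1 + (p_succ (~~ i))^-1))%:E.
Proof.
move=> T0; under eq_integral do rewrite cycle_time_series//.
have iE m x : (`[< in_cycle (path_of x) i k m >]%:R : R) = \1_(cycle_ev k m) x.
  by [].
under eq_integral do under eq_eseriesr do rewrite iE EFinM.
have mI m : measurable_fun setT (EFin \o (\1_(cycle_ev k m) : T -> R)).
  by apply/measurable_EFinP; exact: measurable_indic.
(* Nonnegative terms allow exchanging expectation and series, leaving [Tslot] times the
   probabilities summed in [count_ev_series]. *)
rewrite integral_nneseries//=; last 2 first.
- by move=> m; apply: measurable_funeM; exact: mI.
- by move=> m x _; rewrite lee_fin mulr_ge0// ltW.
have intE m : (\int[P]_x (Tslot%:E * (\1_(cycle_ev k m) x)%:E) =
    (Tslot * Pr (count_ev k m))%:E)%E.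
  rewrite ge0_integralZl//=; [|exact: mI|by rewrite lee_fin ltW].
  by rewrite integral_indic// setIT -Pr_cycle_ev EFinM [X in (_ * X)%E]Pr_EFin.
under eq_eseriesr do rewrite intE.
apply/cvg_lim => //.
under eq_fun do rewrite sumEFin -mulr_sumr.
apply: cvg_EFin; first exact: nearW.
rewrite /comp /=; apply: cvgM; first exact: cvg_cst.
by have := @count_ev_series k; rewrite seriesEnat.
Qed.

End Events.

Theorem theorem1 (R : realType) (d : measure_display) (T : measurableType d)
    (P : probability T R) (tx : bool -> nat -> T -> bool)
    (pA pB Tslot : R) :
  0 < pA < 1 -> 0 < pB < 1 -> 0 < Tslot ->
  (forall i k, measurable [set x | tx i k x]) ->
  (forall k, P [set x | tx true k x] = pA%:E) ->
  (forall k, P [set x | tx false k x] = pB%:E) ->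
  mutually_independent P (fun ik : bool * nat => [set x | tx ik.1 ik.2 x]) ->
  forall k : nat,
    channel_cycle_time P tx Tslot k =
    ((((1 - pA) * pB + (1 - pB) * pA) / ((1 - pA) * (1 - pB) * pA * pB)) * Tslot)%:E.
Proof.
move=> pA01 pB01 T0 mtx PA PB indep k.
pose p n := if n then pA else pB.
have p01 n : 0 < p n < 1 by case: n.
have Ptx n l : P [set x | tx n l x] = (p n)%:E by case: n.
rewrite /channel_cycle_time (integral_cycle_time p01 mtx Ptx indep true k T0).
rewrite (integral_cycle_time p01 mtx Ptx indep false k T0) -EFinD -EFinM.
(* The sum of the two inverses is symmetric in the users, so both expectations agree and the factor
   [2^-1] cancels. *)
congr (_%:E); rewrite /p_succ /p /=; field.
by apply/and4P; split; apply/lt0r_neq0; lra.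
Qed.
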